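(* Let $\mathcal{L}=(L,\wedge,\vee,*,\rightarrowtail,0,1)$ be a BL-algebra, let $T_*$ be the topology on $L$ consisting of all $*$-open subsets of $L$, and let $\mathbf{T}_*$ be the topology on $L^2$ consisting of all $*$-open subsets of $L^2$. Then the mappings $*:(L^2,\mathbf{T}_* )\to(L,T_* )$ and $\rightarrowtail:(L^2,\mathbf{T}_* )\to(L,T_* )$ are continuous.
   Context: A BL-algebra is an algebra $\mathcal{L}=(L,\wedge,\vee,*,\rightarrowtail,0,1)$ of type $(2,2,2,2,0,0)$ such that: (BL1) $(L,\wedge,\vee,0,1)$ is a bounded lattice with greatest element $1$ and smallest element $0$; (BL2) $(L,*,1)$ is an Abelian monoid; (BL3) $c\le a\rightarrowtail b$ iff $c*a\le b$ for all $a,b,c\in L$; (BL4) $a\wedge b=a*(a\rightarrowtail b)$ for all $a,b\in L$; (BL5) $(a\rightarrowtail b)\vee(b\rightarrowtail a)=1$ for all $a,b\in L$. An element $a\in L$ is strongly less than $1$, written $a\ll 1$, if for every $b\in L$, $a\vee b=1$ implies $b=1$. Elements of $L^2$ are written $\mathbf{a}=(a_1,a_2)$. Define $a\leftrightarrow b=(a\rightarrowtail b)*(b\rightarrowtail a)$ for $a,b\in L$ and $\mathbf{a}\Leftrightarrow\mathbf{b}=(a_1\leftrightarrow b_1)*(a_2\leftrightarrow b_2)$ for $\mathbf{a},\mathbf{b}\in L^2$. For $r\in L$ with $r\ll 1$, $a\in L$ and $\mathbf{a}\in L^2$, the $*$-balls are $B_r(a)=\{b\in L: a\leftrightarrow b>r\}$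 and $\mathbf{B}_r(\mathbf{a})=\{\mathbf{b}\in L^2:\mathbf{a}\Leftrightarrow\mathbf{b}>r\}$ (where $x>r$ means $r\le x$ and $r\neq x$). A subset $G\subseteq L$ is $*$-open if for every $a\in G$ there exists $r\in L$ with $r\ll 1$ and $B_r(a)\subseteq G$. A subset $G\subseteq L^2$ is $*$-open if for every $\mathbf{a}\in G$ there exists $r\in L$ with $r\ll 1$ and $\mathbf{B}_r(\mathbf{a})\subseteq G$. The $*$-open subsets of $L$ (respectively $L^2$) form a topology. *)

(* Defs.v *)
From HB Require Import structures.
From mathcomp Require Import all_boot all_order.
From mathcomp Require Import boolp classical_sets topology_structure.

Set Implicit Arguments.
Unset Strict Implicit.
Unset Printing Implicit Defensive.

Import Order.TTheory.
Local Open Scope classical_set_scope.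
Local Open Scope order_scope.

(* The bounded lattice is a [tbLatticeType], with 0 = [\bot] and 1 = [\top];
   it may be trivial (\bot = \top). *)
HB.mixin Record isBLAlgebra (d : Order.disp_t) L of Order.TBLattice d L := {
  bl_mul : L -> L -> L;
  bl_imp : L -> L -> L;
  bl_mulA : associative bl_mul;
  bl_mulC : commutative bl_mul;
  bl_mul1x : left_id (\top : L) bl_mul;
  bl_residuation : forall a b c : L, c <= bl_imp a b <-> bl_mul c a <= b;
  bl_divisibility : forall a b : L, a `&` b = bl_mul a (bl_imp a b);
  bl_prelinearity : forall a b : L, bl_imp a b `|` bl_imp b a = \top
}.

#[short(type="blAlgebraType")]
HB.structure Definition BLAlgebra (d : Order.disp_t) :=
  {L of Order.TBLattice d L & isBLAlgebra d L}.

Section Star.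
Context {d : Order.disp_t} {L : blAlgebraType d}.

Definition strongly_lt1 (a : L) : Prop :=
  forall b : L, a `|` b = \top -> b = \top.

Definition bl_iff (a b : L) : L := bl_mul (bl_imp a b) (bl_imp b a).

Definition bl_iff2 (a b : L * L) : L :=
  bl_mul (bl_iff a.1 b.1) (bl_iff a.2 b.2).

Definition star_ball (r a : L) : set L := [set b | r < bl_iff a b].

Definition star_ball2 (r : L) (a : L * L) : set (L * L) :=
  [set b | r < bl_iff2 a b].

Definition star_open (G : set L) : Prop :=
  forall a, G a -> exists2 r : L, strongly_lt1 r & star_ball r a `<=` G.

Definition star_open2 (G : set (L * L)) : Prop :=
  forall a, G a -> exists2 r : L, strongly_lt1 r & star_ball2 r a `<=` G.

Lemma strongly_lt1_bot : strongly_lt1 \bot.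
Proof. by move=> b; rewrite join0x. Qed.

Lemma strongly_lt1_join (r s : L) :
  strongly_lt1 r -> strongly_lt1 s -> strongly_lt1 (r `|` s).
Proof. by move=> hr hs b; rewrite -joinA => /hr /hs. Qed.

Lemma star_openT : star_open setT.
Proof. by move=> a _; exists \bot => //; exact: strongly_lt1_bot. Qed.

Lemma star_openI : setI_closed star_open.
Proof.
move=> A B oA oB a [/oA[r hr rA] /oB[s hs sB]].
exists (r `|` s); first exact: strongly_lt1_join.
by move=> b hb; split; [apply: rA|apply: sB]; apply: le_lt_trans hb;
  rewrite ?leUl ?leUr.
Qed.

Lemma star_open_bigcup (I : Type) (f : I -> set L) :
  (forall i, star_open (f i)) -> star_open (\bigcup_i f i).
Proof.
move=> of_ a [i _ /of_[r hr rf]]; exists r => // b /rf fb.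
by exists i.
Qed.

Lemma star_open2T : star_open2 setT.
Proof. by move=> a _; exists \bot => //; exact: strongly_lt1_bot. Qed.

Lemma star_open2I : setI_closed star_open2.
Proof.
move=> A B oA oB a [/oA[r hr rA] /oB[s hs sB]].
exists (r `|` s); first exact: strongly_lt1_join.
by move=> b hb; split; [apply: rA|apply: sB]; apply: le_lt_trans hb;
  rewrite ?leUl ?leUr.
Qed.

Lemma star_open2_bigcup (I : Type) (f : I -> set (L * L)) :
  (forall i, star_open2 (f i)) -> star_open2 (\bigcup_i f i).
Proof.
move=> of_ a [i _ /of_[r hr rf]]; exists r => // b /rf fb.
by exists i.
Qed.

End Star.

(* Aliases of [L] and [L * L] carrying the topologies of *-open sets.  The
   second one is not the product topology of the first, hence the separate
   alias, which hides the library's canonical topology on pairs. *)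
Definition star_space (d : Order.disp_t) (L : blAlgebraType d) : Type := L.

Definition star_space2 (d : Order.disp_t) (L : blAlgebraType d) : Type :=
  (L * L)%type.

HB.instance Definition _ (d : Order.disp_t) (L : blAlgebraType d) :=
  Choice.copy (star_space L) L.
HB.instance Definition _ (d : Order.disp_t) (L : blAlgebraType d) :=
  isOpenTopological.Build (star_space L)
    (@star_openT d L) (@star_openI d L) (@star_open_bigcup d L).

HB.instance Definition _ (d : Order.disp_t) (L : blAlgebraType d) :=
  Choice.copy (star_space2 L) (L * L)%type.
HB.instance Definition _ (d : Order.disp_t) (L : blAlgebraType d) :=
  isOpenTopological.Build (star_space2 L)
    (@star_open2T d L) (@star_open2I d L) (@star_open2_bigcup d L).

Lemma star_space_openE (d : Order.disp_t) (L : blAlgebraType d)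
  (G : set (star_space L)) : open G = star_open (G : set L).
Proof. by []. Qed.

Lemma star_space2_openE (d : Order.disp_t) (L : blAlgebraType d)
  (G : set (star_space2 L)) : open G = star_open2 (G : set (L * L)).
Proof. by []. Qed.

(* Main.v *)
(* Both operations are non-expansive for the biresiduum: [a <=> b] is below
   both [a1 * a2 <-> b1 * b2] and [(a1 >-> a2) <-> (b1 >-> b2)].  Hence each
   operation maps the ball of radius [r] around [a] in [L^2] into the ball of the
   same radius [r] around the image of [a]. *)
From HB Require Import structures.
Require Import Defs.
From mathcomp Require Import all_boot all_order.
From mathcomp Require Import boolp classical_sets filter topology_structure.

Set Implicit Arguments.
Unset Strict Implicit.
Unset Printing Implicit Defensive.

Import Order.TTheory.
Local Open Scope classical_set_scope.
Local Open Scope order_scope.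

(** Makes the generic rearrangement lemmas [mulmACA] and [mulmCA] available for [bl_mul]. *)
HB.instance Definition _ (d : Order.disp_t) (L : blAlgebraType d) :=
  SemiGroup.isComLaw.Build L (@bl_mul d L) (@bl_mulA d L) (@bl_mulC d L).

Section Nonexpansive.
Context {d : Order.disp_t} {L : blAlgebraType d}.
Implicit Types (a b c : L) (p q : L * L).

Lemma bl_imp_mul_le a b : bl_mul (bl_imp a b) a <= b.
Proof. exact/bl_residuation. Qed.

Lemma bl_mul_le2r c a b : a <= b -> bl_mul a c <= bl_mul b c.
Proof.
by move=> ab; apply/bl_residuation/(le_trans ab); apply/bl_residuation.
Qed.

Lemma bl_mul_le2 a b a' b' :
  a <= a' -> b <= b' -> bl_mul a b <= bl_mul a' b'.
Proof.
move=> aa' bb'; apply: (le_trans (bl_mul_le2r b aa')).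
by rewrite ![bl_mul a' _]bl_mulC bl_mul_le2r.
Qed.

Lemma bl_mul_imp_le a a' b b' :
  bl_mul (bl_imp a b) (bl_imp a' b') <= bl_imp (bl_mul a a') (bl_mul b b').
Proof.
(* The interchange puts each implication next to its own premise. *)
apply/bl_residuation; rewrite SemiGroup.Theory.mulmACA.
by apply: bl_mul_le2; exact: bl_imp_mul_le.
Qed.

(** After residuating twice, this is a chain of three modus ponens steps, from [b] to [a] to [a'] to
    [b']. *)
Lemma bl_imp_imp_le a a' b b' :
  bl_mul (bl_imp b a) (bl_imp a' b') <= bl_imp (bl_imp a a') (bl_imp b b').
Proof.
apply/bl_residuation/bl_residuation.
rewrite [bl_mul (bl_imp b a) _]bl_mulC -!bl_mulA.
apply: le_trans (bl_imp_mul_le a' b'); apply: bl_mul_le2 => //.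
rewrite SemiGroup.Theory.mulmCA; apply: le_trans (bl_imp_mul_le a a').
by apply: bl_mul_le2 => //; exact: bl_imp_mul_le.
Qed.

Lemma bl_iff2_mul p q :
  bl_iff2 p q <= bl_iff (bl_mul p.1 p.2) (bl_mul q.1 q.2).
Proof.
(* Regroup the four implications: those from [p] to [q], then those from [q] to [p]. *)
rewrite /bl_iff2 /bl_iff SemiGroup.Theory.mulmACA.
by apply: bl_mul_le2; exact: bl_mul_imp_le.
Qed.

Lemma bl_iff2_imp p q :
  bl_iff2 p q <= bl_iff (bl_imp p.1 p.2) (bl_imp q.1 q.2).
Proof.
(* Implication is antitone in its first argument, so [bl_imp q.1 p.1] has to be paired with
   [bl_imp p.2 q.2]; hence the swap before the interchange. *)
rewrite /bl_iff2 /bl_iff [bl_mul (bl_imp p.1 _) _]bl_mulC.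
rewrite SemiGroup.Theory.mulmACA.
by apply: bl_mul_le2; exact: bl_imp_imp_le.
Qed.

Lemma nonexpansive_continuous (f : L * L -> L) :
  (forall p q, bl_iff2 p q <= bl_iff (f p) (f q)) ->
  continuous (f : star_space2 L -> star_space L).
Proof.
move=> fP; apply/continuousP => G.
rewrite star_space_openE star_space2_openE => oG p /oG[r hr rG].
by exists r => // q rpq; apply: rG; exact: lt_le_trans rpq (fP p q).
Qed.

End Nonexpansive.

Theorem theorem3p8 (d : Order.disp_t) (L : blAlgebraType d) :
  continuous (fun p : star_space2 L => bl_mul p.1 p.2 : star_space L) /\
  continuous (fun p : star_space2 L => bl_imp p.1 p.2 : star_space L).
Proof.
split; apply: nonexpansive_continuous.
- exact: bl_iff2_mul.
- exact: bl_iff2_imp.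
Qed.
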